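(* Let $H$ be a finite dimensional Hilbert space, $M=M_n$, and let $K$ be a mapping cone in $\mathcal P(H)$. Then $(\mathcal P_K(M)^\flat)^\flat=\mathcal P_K(M)$.
   Context: $M=M_n$ is the algebra of complex $n\times n$ matrices with standard matrix units $(e_{ij})$, and $H$ is a finite dimensional complex Hilbert space. $x^t$ denotes the transpose of $x$ (on $B(H)$ with respect to a fixed orthonormal basis of $H$). $\iota$ is the identity map and $Tr$ the usual trace. $B(M,H)$ is the set of linear maps $M\to B(H)$, $B(M,H)^+$ the positive ones, and $\mathcal P(H)$ the set of positive linear maps $B(H)\to B(H)$. A mapping cone is a nonzero closed (convex) cone $K\subset\mathcal P(H)$ such that $\phi\in K$ and $a,b\in B(H)$ imply that $x\mapsto a\phi(bxb^* )a^*$ belongs to $K$. $P(M,K)=\{x\in M\otimes B(H): (\iota\otimes\alpha)(x)\ge0\ \forall\alpha\in K\}$. For $\phi\in B(M,H)$, $\tilde\phi$ is the linear functional on $M\otimes B(H)$ with $\tilde\phi(a\otimes b)=Tr(\phi(a)b^t)$. A map $\phi\in B(M,H)^+$ is $K$-positive if $\tilde\phi$ takes values $\ge 0$ on $P(M,K)$; $\mathcal P_K(M)$ is the cone of $K$-positive maps. The Choi matrix is $C_\phi=\sum_{ij}e_{ij}\otimes\phi(e_{ij})$. The dual cone of a set $S$ of maps is $S^\flat=\{\phi\in B(M,H): Tr(C_\phi C_\psi)\ge0\ \forall\psi\in S\}$. *)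

(* Defs.v *)
From mathcomp Require Import all_boot all_order all_algebra.
From mathcomp Require Import all_classical all_reals all_analysis.
From mathcomp Require Import complex mxtens.

Set Implicit Arguments.
Unset Strict Implicit.
Unset Printing Implicit Defensive.

Import Order.TTheory GRing.Theory Num.Theory.
Import numFieldNormedType.Exports.

Local Open Scope classical_set_scope.
Local Open Scope ring_scope.
Local Open Scope sesquilinear_scope.

(** [H] is [C^m] with its standard orthonormal basis, so that [B(H)] is
    ['M[C]_m], the adjoint is the conjugate transpose [_^t*] and the transpose is
    [trmx].  A linear map [M_n -> B(H)] is an element of
    ['Hom('M[C]_n, 'M[C]_m)], and [M_n (x) B(H)] is ['M[C]_(n * m)], the
    elementary tensors being the Kronecker products [a *t b].  The definitions
    make sense over any [numClosedFieldType]; the intended one is [R[i]] with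
    [R : realType]. *)

Section Maps.
Variable C : numClosedFieldType.

(** In a [numClosedFieldType], [0 <= z] says that [z] is real and nonnegative;
    in particular a positive matrix is Hermitian. *)
Definition posmx p (a : 'M[C]_p) : Prop :=
  forall v : 'cV[C]_p, 0 <= (v^t* *m a *m v) 0 0.

Definition posmap n m (phi : 'Hom('M[C]_n, 'M[C]_m)) : Prop :=
  forall x, posmx x -> posmx (phi x).

Definition tblock n m (x : 'M[C]_(n * m)) (i j : 'I_n) : 'M[C]_m :=
  \matrix_(k, l) x (mxtens_index (i, k)) (mxtens_index (j, l)).

Lemma tens_decomp n m (x : 'M[C]_(n * m)) :
  x = \sum_i \sum_j (delta_mx i j : 'M[C]_n) *t tblock x i j.
Proof.
apply/matrixP => s t.
case: (mxtens_indexP s) => i k; case: (mxtens_indexP t) => j l.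
rewrite summxE (bigD1 i) //= summxE (bigD1 j) //= tensmxE !mxE !eqxx mul1r.
rewrite !big1 ?addr0 // => [i' ne_i'|j' ne_j'].
  rewrite summxE big1 // => j' _.
  by rewrite tensmxE !mxE eq_sym (negPf ne_i') mul0r.
by rewrite tensmxE !mxE eqxx eq_sym (negPf ne_j') mul0r.
Qed.

Lemma tblock_tens n m (a : 'M[C]_n) (b : 'M[C]_m) i j :
  tblock (a *t b) i j = a i j *: b.
Proof. by apply/matrixP => k l; rewrite !mxE !mxtens_indexK. Qed.

(** [iota (x) alpha], the linear map such that
    [a *t b |-> a *t alpha b]; see [idtens_tens]. *)
Definition idtens n m (alpha : 'End('M[C]_m)) (x : 'M[C]_(n * m)) :
    'M[C]_(n * m) :=
  \sum_i \sum_j (delta_mx i j : 'M[C]_n) *t alpha (tblock x i j).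

Lemma idtens_tens n m (alpha : 'End('M[C]_m)) (a : 'M[C]_n) (b : 'M[C]_m) :
  idtens alpha (a *t b) = a *t alpha b.
Proof.
rewrite (tens_decomp (a *t alpha b)); apply: eq_bigr => i _.
by apply: eq_bigr => j _; rewrite !tblock_tens linearZ.
Qed.

(** The functional [phi~], i.e. the linear form such that
    [a *t b |-> \tr (phi a *m b^T)]; see [tfun_tens]. *)
Definition tfun n m (phi : 'Hom('M[C]_n, 'M[C]_m)) (x : 'M[C]_(n * m)) : C :=
  \sum_i \sum_j \tr (phi (delta_mx i j) *m (tblock x i j)^T).

Lemma tfun_tens n m (phi : 'Hom('M[C]_n, 'M[C]_m)) a b :
  tfun phi (a *t b) = \tr (phi a *m b^T).
Proof.
rewrite {2}(matrix_sum_delta a) linear_sum /= mulmx_suml raddf_sum /=.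
apply: eq_bigr => i _; rewrite linear_sum /= mulmx_suml raddf_sum /=.
apply: eq_bigr => j _; rewrite tblock_tens !linearZ /=.
by rewrite -scalemxAl linearZ.
Qed.

Definition choi n m (phi : 'Hom('M[C]_n, 'M[C]_m)) : 'M[C]_(n * m) :=
  \sum_i \sum_j delta_mx i j *t phi (delta_mx i j).

(** The space of linear maps on ['M[C]_m] is finite dimensional, so its usual
    topology is that of pointwise convergence, and it is closed in the space
    of all functions. *)
Definition closed_maps m (K : set 'End('M[C]_m)) : Prop :=
  closed ((fun phi => phi : {ptws 'M[C]_m -> 'M[C]_m}) @` K).

Record mapping_cone m (K : set 'End('M[C]_m)) : Prop := MappingCone {
  mcone_pos : forall phi, K phi -> posmap phi;
  mcone_neq0 : exists2 phi, K phi & phi != 0;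
  mcone_closed : closed_maps K;
  mcone_add : forall phi psi, K phi -> K psi -> K (phi + psi);
  mcone_scale : forall (c : C) phi, 0 <= c -> K phi -> K (c *: phi);
  mcone_ideal : forall (a b : 'M[C]_m) (phi psi : 'End('M[C]_m)), K phi ->
    (forall x, psi x = a *m phi (b *m x *m b^t*) *m a^t*) -> K psi }.

(** The cone [P(M_n, K)]. *)
Definition PMK n m (K : set 'End('M[C]_m)) : set 'M[C]_(n * m) :=
  [set x | forall alpha, K alpha -> posmx (idtens alpha x)].

(** The cone of [K]-positive maps [M_n -> B(H)]. *)
Definition Kpos n m (K : set 'End('M[C]_m)) : set 'Hom('M[C]_n, 'M[C]_m) :=
  [set phi | posmap phi /\ forall x, PMK K x -> 0 <= tfun phi x].

Definition dual_cone n m (S : set 'Hom('M[C]_n, 'M[C]_m)) :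
    set 'Hom('M[C]_n, 'M[C]_m) :=
  [set phi | forall psi, S psi -> 0 <= \tr (choi phi *m choi psi)].

End Maps.

Arguments PMK {C} n {m} K.
Arguments Kpos {C} n {m} K.

(* Main.v *)
(** [K]-positivity of [phi] is a family of inequalities [0 <= tfun phi x], and
    so is plain positivity, with [x = a *t (v v^* )^T] for positive [a].
    Each [tfun _ x] is the trace pairing with the map whose Choi matrix is
    [x^T].  Hence [Kpos n K] is itself the dual cone of a set of maps, and for
    such cones the bidual identity is formal. *)
Require Import Defs.
From HB Require Import structures.
From mathcomp Require Import all_boot all_order all_algebra.
From mathcomp Require Import all_classical all_reals all_analysis.
From mathcomp Require Import complex.
From mathcomp Require Import mxtens.

Local Open Scope classical_set_scope.
Local Open Scope ring_scope.
Local Open Scope complex_scope.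

Import GRing.Theory.

Section TracePairing.
Local Open Scope sesquilinear_scope.
Variables (C : numClosedFieldType) (n m : nat).
Implicit Types (x y : 'M[C]_(n * m)) (phi psi : 'Hom('M[C]_n, 'M[C]_m)).

(** An index of [n * m] is a pair, so the trace and the matrix product each split into a sum over
    blocks and a sum inside a block. *)
Lemma mxtrace_mul_tblock x y :
  \tr (x *m y) = \sum_i \sum_j \tr (tblock x i j *m tblock y j i).
Proof.
have sum_tens (F : 'I_(n * m) -> C) :
    \sum_s F s = \sum_i \sum_k F (mxtens_index (i, k)).
  rewrite pair_big /= (reindex (@mxtens_index n m)) /=.
    by apply: eq_bigr => -[].
  by exists (@mxtens_unindex n m) => s _;
    [exact: mxtens_indexK | exact: mxtens_unindexK].
rewrite /mxtrace sum_tens; apply: eq_bigr => i _.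
rewrite exchange_big; apply: eq_bigr => k _ /=.
rewrite mxE sum_tens; apply: eq_bigr => j _.
by rewrite mxE; apply: eq_bigr => l _; rewrite !mxE.
Qed.

Lemma tblock_choi phi i j : tblock (choi phi) i j = phi (delta_mx i j).
Proof.
apply/matrixP => k l; rewrite mxE summxE (bigD1 i) //= summxE (bigD1 j) //=.
rewrite tensmxE !mxE !eqxx mul1r.
rewrite !big1 ?addr0 // => [i' ne_i'|j' ne_j'].
  rewrite summxE big1 // => j' _.
  by rewrite tensmxE !mxE eq_sym (negPf ne_i') mul0r.
by rewrite tensmxE !mxE eqxx eq_sym (negPf ne_j') mul0r.
Qed.

(** The inverse of [choi]. [linfun] receives a bare function, so evaluating it requires a proof that
    this function is linear. *)
Definition map_of_choi x : 'Hom('M[C]_n, 'M[C]_m) :=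
  linfun (fun a : 'M[C]_n => \sum_i \sum_j a i j *: tblock x i j).

Lemma map_of_choi_delta x i j : map_of_choi x (delta_mx i j) = tblock x i j.
Proof.
set f := fun a : 'M[C]_n => \sum_i \sum_j a i j *: tblock x i j.
have f_lin : linear f.
  move=> c a b; rewrite /f scaler_sumr -big_split; apply: eq_bigr => k _ /=.
  rewrite scaler_sumr -big_split; apply: eq_bigr => l _ /=.
  by rewrite !mxE scalerDl scalerA.
pose fL := GRing.isLinear.Build _ _ _ _ f f_lin.
pose F : {linear 'M[C]_n -> 'M[C]_m} := HB.pack f fL.
rewrite /map_of_choi -/f -[f]/(F : _ -> _) lfunE /= /f.
rewrite (bigD1 i) //= (bigD1 j) //= mxE !eqxx scale1r.
rewrite !big1 ?addr0 // => [i' ne_i'|j' ne_j'].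
  by rewrite big1 // => j' _; rewrite mxE (negPf ne_i') scale0r.
by rewrite mxE eqxx (negPf ne_j') scale0r.
Qed.

(** The trace pairs block (i, j) with block (j, i), while [tfun] pairs it with the transposed block
    (i, j). Transposing all of [x] both swaps the block indices and transposes each block. *)
Lemma tfun_choi phi x :
  tfun phi x = \tr (choi phi *m choi (map_of_choi x^T)).
Proof.
rewrite mxtrace_mul_tblock; apply: eq_bigr => i _; apply: eq_bigr => j _.
rewrite !tblock_choi map_of_choi_delta; congr (\tr (_ *m _)).
by apply/matrixP => k l; rewrite !mxE.
Qed.

(** The two transposes cancel, and cyclicity of the trace leaves a 1 x 1 matrix. *)
Lemma tfun_quadratic_form phi (a : 'M[C]_n) (v : 'cV[C]_m) :
  tfun phi (a *t (v *m v^t*)^T) = (v^t* *m phi a *m v) 0 0.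
Proof.
by rewrite tfun_tens trmxK mulmxA mxtrace_mulC mulmxA /mxtrace big_ord1.
Qed.

Lemma dual_dual_tfun_ge0 (S : set 'Hom('M[C]_n, 'M[C]_m)) x :
  (forall psi, S psi -> 0 <= tfun psi x) ->
  forall phi, dual_cone (dual_cone S) phi -> 0 <= tfun phi x.
Proof.
(* By symmetry of the trace, [S_ge0] puts [map_of_choi x^T] in [dual_cone S], and [phi] is tested
   against it. *)
move=> S_ge0 phi Sphi; rewrite tfun_choi; apply: Sphi => psi Spsi.
by rewrite mxtrace_mulC -tfun_choi; exact: S_ge0.
Qed.

Lemma subset_dual_dual (S : set 'Hom('M[C]_n, 'M[C]_m)) :
  S `<=` dual_cone (dual_cone S).
Proof. by move=> phi Sphi psi Spsi; rewrite mxtrace_mulC; exact: Spsi. Qed.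

End TracePairing.

Theorem theorem6 (R : realType) (n m : nat) (K : set 'End('M[R[i]]_m))
    (hK : mapping_cone K) :
  dual_cone (dual_cone (Kpos n K)) = Kpos n K.
Proof.
apply/seteqP; split; last exact: subset_dual_dual.
move=> phi phiDD; split=> [a a_ge0 v | x PMKx].
  (* Positivity at [a] and [v] is one [tfun] inequality, valid for every positive [psi], so it
     passes to the bidual. *)
  rewrite -tfun_quadratic_form; apply: dual_dual_tfun_ge0 phiDD => psi [psi_ge0 _].
  by rewrite tfun_quadratic_form; exact: psi_ge0.
by apply: dual_dual_tfun_ge0 phiDD => psi [_]; exact.
Qed.
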